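(* Let $d\ge 1$, let $A_0\in\mathbb{C}^{d\times d}$, and let $A_\infty=\lim_{t\to\infty}\mathcal{F}(A_0,t)$ be its limit under the negative gradient flow $\mathcal{F}$ of the function $\mathrm{E}(A)=\|AA^*-A^*A\|^2$ on $\mathbb{C}^{d\times d}$. Then $$\|A_0\|^2-\|A_\infty\|^2=\mathrm{Hen}(A_0),$$ where $\mathrm{Hen}(A_0)$ is the Henrici departure from normality of $A_0$.
   Context: $\mathbb{C}^{d\times d}$ is regarded as a real inner product space with $\langle A,B\rangle=\mathrm{Re}\,\mathrm{tr}(B^*A)$; $\|\cdot\|$ is the Frobenius norm, $\|B\|^2=\sum_{i,j}|b_{ij}|^2$. The negative gradient flow $\mathcal{F}:\mathbb{C}^{d\times d}\times[0,\infty)\to\mathbb{C}^{d\times d}$ is defined by $\mathcal{F}(A_0,0)=A_0$ and $\frac{d}{dt}\mathcal{F}(A_0,t)=-\nabla\mathrm{E}(\mathcal{F}(A_0,t))$, with $\nabla$ the gradient with respect to $\langle\cdot,\cdot\rangle$; the limit $A_\infty$ exists for every $A_0$. The Henrici departure from normality of a matrix $A\in\mathbb{C}^{d\times d}$ with eigenvalues $\lambda_1,\dots,\lambda_d$ (listed with algebraic multiplicity) is $\mathrm{Hen}(A)=\|A\|^2-\sum_{i=1}^d|\lambda_i|^2$. *)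

(* Defs.v *)
From HB Require Import structures.
From mathcomp Require Import all_boot all_order all_algebra.
From mathcomp Require Import all_classical all_reals all_analysis.
From mathcomp Require Import complex ring.

Set Implicit Arguments.
Unset Strict Implicit.
Unset Printing Implicit Defensive.

Import Order.TTheory GRing.Theory Num.Theory.
Import numFieldNormedType.Exports.
Import ComplexField.Normc.

Local Open Scope classical_set_scope.
Local Open Scope sesquilinear_scope.
Local Open Scope complex_scope.
Local Open Scope ring_scope.

(* Complex d x d matrices as a normed space over the reals. This is an alias,
   because 'M[R[i]]_d already carries the scaling by R[i] (and, in
   MathComp-Analysis, the max norm). *)
Definition cmatrix (R : realType) (d : nat) : Type := 'M[R[i]]_d.

HB.instance Definition _ (R : realType) (d : nat) :=
  GRing.Zmodule.on (cmatrix R d).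

Section RealSpace.
Variables (R : realType) (d : nat).
Implicit Types (a b : R) (A B C : cmatrix R d).

Definition rscale a A : cmatrix R d := \matrix_(i, j) (a%:C * A i j).

Let rscaleA a b A : rscale a (rscale b A) = rscale (a * b) A.
Proof. by apply/matrixP => i j; rewrite !mxE rmorphM/= mulrA. Qed.

Let rscale1 : left_id 1 rscale.
Proof. by move=> A; apply/matrixP => i j; rewrite !mxE mul1r. Qed.

Let rscaleDr : right_distributive rscale +%R.
Proof. by move=> a A B; apply/matrixP => i j; rewrite !mxE mulrDr. Qed.

Let rscaleDl A : {morph rscale^~ A : a b / a + b}.
Proof. by move=> a b; apply/matrixP => i j; rewrite !mxE rmorphD/= mulrDl. Qed.

HB.instance Definition _ := GRing.Zmodule_isLmodule.Build R (cmatrix R d)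
  rscaleA rscale1 rscaleDr rscaleDl.

Definition inner A B : R := complex.Re (\tr (B ^t* *m A)).

Definition frobenius A : R := Num.sqrt (\sum_i \sum_j normc (A i j) ^+ 2).

Let sqr_normcE (z : R[i]) :
  normc z ^+ 2 = complex.Re z ^+ 2 + complex.Im z ^+ 2.
Proof. by case: z => x y /=; rewrite sqr_sqrtr// addr_ge0// sqr_ge0. Qed.

Lemma innerE A B : inner A B = \sum_i \sum_j
  (complex.Re (A i j) * complex.Re (B i j) +
   complex.Im (A i j) * complex.Im (B i j)).
Proof.
rewrite /inner /mxtrace raddf_sum exchange_big; apply: eq_bigr => i _.
rewrite mxE raddf_sum; apply: eq_bigr => j _; rewrite !mxE.
by case: (A j i) (B j i) => [a b] [x y] /=; rewrite mulNr opprK ![_ * a]mulrC ![_ * b]mulrC.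
Qed.

Lemma innerC A B : inner A B = inner B A.
Proof.
rewrite !innerE; apply: eq_bigr => i _; apply: eq_bigr => j _.
by rewrite mulrC [X in _ + X]mulrC.
Qed.

Lemma innerDl A B C : inner (A + B) C = inner A C + inner B C.
Proof. by rewrite /inner mulmxDr mxtraceD raddfD. Qed.

Lemma innerZl a A B : inner (a *: A) B = a * inner A B.
Proof.
rewrite !innerE mulr_sumr; apply: eq_bigr => i _; rewrite mulr_sumr.
apply: eq_bigr => j _; rewrite !mxE; case: (A i j) (B i j) => [x y] [z t] /=.
by rewrite !mul0r subr0 addr0 mulrDr !mulrA.
Qed.

Lemma innerDr A B C : inner A (B + C) = inner A B + inner A C.
Proof. by rewrite innerC innerDl ![inner _ A]innerC. Qed.

Lemma innerZr a A B : inner A (a *: B) = a * inner A B.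
Proof. by rewrite innerC innerZl innerC. Qed.

Lemma inner_norm A : inner A A = \sum_i \sum_j normc (A i j) ^+ 2.
Proof.
rewrite innerE; apply: eq_bigr => i _; apply: eq_bigr => j _.
by rewrite sqr_normcE.
Qed.

Lemma inner_ge0 A : 0 <= inner A A.
Proof.
by rewrite inner_norm; apply: sumr_ge0 => i _; apply: sumr_ge0 => j _;
  rewrite sqr_ge0.
Qed.

Lemma inner_eq0 A : inner A A = 0 -> A = 0.
Proof.
rewrite inner_norm => /eqP.
rewrite psumr_eq0; last by move=> i _; apply: sumr_ge0 => j _; rewrite sqr_ge0.
move=> /allP A0; apply/matrixP => i j.
have := A0 i (mem_index_enum i); rewrite /= psumr_eq0; last first.
  by move=> k _; rewrite sqr_ge0.
move=> /allP /(_ j (mem_index_enum j)); rewrite /= sqrf_eq0 => /eqP.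
by move=> /eq0_normc ->; rewrite mxE.
Qed.

Lemma frobeniusE A : frobenius A = Num.sqrt (inner A A).
Proof. by rewrite inner_norm. Qed.

Lemma inner_le A B : inner A B <= frobenius A * frobenius B.
Proof.
rewrite !frobeniusE -sqrtrM ?inner_ge0//.
apply: (le_trans (ler_norm _)); rewrite -sqrtr_sqr ler_sqrt; last first.
  by rewrite mulr_ge0// inner_ge0.
have [B0|B0] := eqVneq (inner B B) 0.
  have -> : inner A B = 0.
    by rewrite (inner_eq0 B0) innerC -(scale0r B) innerZl mul0r.
  by rewrite B0 mulr0 expr0n.
have Bgt0 : 0 < inner B B by rewrite lt_neqAle eq_sym B0 inner_ge0.
have := inner_ge0 (inner B B *: A + (- inner A B) *: B).
set x := inner B B in B0 Bgt0 *; set y := inner A B.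
rewrite innerDl !innerDr !innerZl !innerZr -/x -/y (innerC B A) -/y.
rewrite [X in 0 <= X](_ : _ = x * (inner A A * x - y ^+ 2)).
  by rewrite pmulr_rge0// subr_ge0.
by ring.
Qed.

Let frobenius_triangle A B :
  frobenius (A + B) <= frobenius A + frobenius B.
Proof.
have f0 C : 0 <= frobenius C by rewrite sqrtr_ge0.
have fE C : frobenius C ^+ 2 = inner C C.
  by rewrite frobeniusE sqr_sqrtr// inner_ge0.
rewrite -ler_sqr ?nnegrE ?addr_ge0// sqrrD !fE.
rewrite innerDl !innerDr (innerC B A).
by rewrite addrA lerD2r -addrA lerD2l -mulr2n lerMn2r/= inner_le.
Qed.

Let frobeniusZ a A : frobenius (a *: A) = `|a| * frobenius A.
Proof.
by rewrite !frobeniusE innerZl innerZr mulrA sqrtrM ?sqrtr_sqr// -expr2 sqr_ge0.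
Qed.

Let frobenius0_eq0 A : frobenius A = 0 -> A = 0.
Proof.
rewrite frobeniusE => /eqP; rewrite sqrtr_eq0 => A0.
by apply: inner_eq0; apply/eqP; rewrite eq_le A0 inner_ge0.
Qed.

HB.instance Definition _ := @Lmodule_isNormed.Build R (cmatrix R d)
  frobenius frobenius_triangle frobeniusZ frobenius0_eq0.

End RealSpace.

Section Flow.
Variables (R : realType) (d : nat).
Implicit Types (A B : cmatrix R d) (f : cmatrix R d -> R^o).

Definition is_gradient f A (G : cmatrix R d) : Prop :=
  differentiable f A /\ forall H : cmatrix R d, 'd f A H = inner H G.

(* Unspecified where f is not differentiable. *)
Definition gradient f A : cmatrix R d := xget 0 [set G | is_gradient f A G].

Lemma gradientP f A (G : cmatrix R d) : is_gradient f A G -> gradient f A = G.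
Proof.
move=> fG; apply: xget_unique => // G' [_ fG'].
apply/eqP; rewrite -subr_eq0; apply/eqP/inner_eq0.
have {}fG' H : inner H G' = inner H G by rewrite -fG' fG.2.
by rewrite -[X in _ + X]scaleN1r innerDr innerZr fG' mulN1r subrr.
Qed.

Definition energy A : R^o := `|(A *m A ^t* - A ^t* *m A : cmatrix R d)| ^+ 2.

(* The time domain is [0, +oo): the difference quotient at t ranges over the
   h <> 0 with t + h >= 0, so that it is one-sided at t = 0. Values of the flow
   at negative times are irrelevant. *)
Definition has_time_derivative (phi : R -> cmatrix R d) (t : R)
    (V : cmatrix R d) : Prop :=
  h^-1 *: (phi (t + h) - phi t) @[h --> within [set h | 0 <= t + h] (0 : R)^']
    --> V.

Definition negative_gradient_flow
    (f : cmatrix R d -> R^o) (F : cmatrix R d -> R -> cmatrix R d) : Prop :=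
  forall A, F A 0 = A /\
    forall t, 0 <= t -> has_time_derivative (F A) t (- gradient f (F A t)).

Definition eigenvalues A : seq R[i] :=
  sval (closed_field_poly_normal (char_poly A)).

Lemma eigenvaluesP A :
  char_poly A = \prod_(l <- eigenvalues A) ('X - l%:P).
Proof.
rewrite /eigenvalues; case: closed_field_poly_normal => r /= {1}->.
by rewrite (monicP (char_poly_monic A)) scale1r.
Qed.

Definition henrici A : R :=
  `|A| ^+ 2 - \sum_(l <- eigenvalues A) normc l ^+ 2.

End Flow.

(* Main.v *)
From HB Require Import structures.
Require Import Defs.
From mathcomp Require Import all_boot all_order all_algebra.
From mathcomp Require Import all_classical all_reals all_analysis.
From mathcomp Require Import complex ring lra.

Set Implicit Arguments.
Unset Strict Implicit.
Unset Printing Implicit Defensive.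

Import Order.TTheory GRing.Theory Num.Theory.
Import numFieldNormedType.Exports.
Import ComplexField.Normc.

Local Open Scope classical_set_scope.
Local Open Scope sesquilinear_scope.
Local Open Scope complex_scope.
Local Open Scope ring_scope.

(* With C = [A, A^*], the gradient of E is 4 [C, A], so the flow is the Lax
   equation A' = [A, 4 C]. Every power of A solves the same equation, hence
   the traces tr (A^k), which are the power sums of the eigenvalues, are
   constant along the flow and pass to the limit: A_0 and A_oo have the same
   sum of |lambda|^2. The limit is a critical point of E, and
   <[A, C], A> = - ||C||^2 shows that a critical point is normal; for a normal
   matrix the squared Frobenius norm is the sum of |lambda|^2. *)

(** * Power sums and eigenvalues *)

(** Unique factorisation: the head of [s1] is a root of the second product, hence occurs in [s2],
    and its linear factor cancels because polynomials over a domain form a domain. *)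
Lemma perm_eq_prod_XsubC (F : idomainType) (s1 s2 : seq F) :
  \prod_(x <- s1) ('X - x%:P) = \prod_(x <- s2) ('X - x%:P) ->
  perm_eq s1 s2.
Proof.
elim: s1 s2 => [|a s1 IH] s2.
  rewrite big_nil; move=> s2E; have := size_prod_XsubC s2 id.
  by rewrite -s2E size_poly1 => -[] /esym/size0nil ->.
move=> s12; have as2 : a \in s2.
  by rewrite -root_prod_XsubC -s12 root_prod_XsubC mem_head.
rewrite perm_sym (perm_trans (perm_to_rem as2))// perm_cons perm_sym IH//.
apply: (@mulfI _ ('X - a%:P)); first by rewrite polyXsubC_eq0.
by move: s12; rewrite big_cons (perm_big _ (perm_to_rem as2)) big_cons.
Qed.

Lemma exists_interpolating_poly (F : fieldType) (f : F -> F) (s : seq F) :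
  exists p : {poly F}, {in s, forall x, p.[x] = f x}.
Proof.
elim: s => [|a s [p pf]]; first by exists 0.
have [as_|as_] := boolP (a \in s).
  by exists p => x; rewrite inE => /orP[/eqP->|/pf//]; exact: pf.
(* Newton interpolation: [q] vanishes on [s] but not at the new node [a], so a multiple of [q]
   corrects the value at [a] and keeps the others. *)
pose q := \prod_(x <- s) ('X - x%:P).
have qa : q.[a] != 0 by rewrite -rootE root_prod_XsubC.
exists (p + ((f a - p.[a]) / q.[a]) *: q) => x.
rewrite inE hornerD hornerZ => /orP[/eqP->|xs].
  by rewrite divfK// addrC subrK.
have /eqP-> : root q x by rewrite root_prod_XsubC.
by rewrite mulr0 addr0 pf.
Qed.

(* Interpolating [f] on both lists makes it a polynomial there. *)
Lemma eq_sum_of_eq_power_sums (F : fieldType) (s1 s2 : seq F) (f : F -> F) :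
  (forall k, \sum_(x <- s1) x ^+ k = \sum_(x <- s2) x ^+ k) ->
  \sum_(x <- s1) f x = \sum_(x <- s2) f x.
Proof.
move=> s12; have [p pf] := exists_interpolating_poly f (s1 ++ s2).
have sumE (s : seq F) : {subset s <= s1 ++ s2} ->
    \sum_(x <- s) f x = \sum_(i < size p) p`_i * \sum_(x <- s) x ^+ i.
  move=> sub; rewrite (eq_bigr (fun i : 'I__ => \sum_(x <- s) p`_i * x ^+ i)).
    rewrite exchange_big; apply: eq_big_seq => x /sub /pf <-.
    by rewrite horner_coef.
  by move=> i _; rewrite mulr_sumr.
rewrite !sumE; first by apply: eq_bigr => i _; rewrite s12.
- by move=> x xs; rewrite mem_cat xs orbT.
- by move=> x xs; rewrite mem_cat xs.
Qed.

(** Here triangular means lower triangular: in a diagonal entry of [T * T ^+ k], the summand of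
    index [l] dies by one factor if [l < i] and by the other if [l > i]. *)
Lemma trig_mx_exp (F : comNzRingType) n (T : 'M[F]_n) k : is_trig_mx T ->
  is_trig_mx (T ^+ k) /\ forall i, (T ^+ k) i i = T i i ^+ k.
Proof.
move=> /is_trig_mxP Tt; elim: k => [|k [/is_trig_mxP IHt IHd]].
  split; last by move=> i; rewrite mxE eqxx.
  by apply/is_trig_mxP => i j; rewrite mxE; case: eqVneq => // ->; rewrite ltnn.
split.
  apply/is_trig_mxP => i j ij; rewrite exprS mxE big1// => l _.
  have [il|li] := ltnP i l; first by rewrite Tt ?mul0r.
  by rewrite [X in _ * X]IHt ?mulr0// (leq_ltn_trans li).
move=> i; rewrite !exprS mxE (bigD1 i)//= IHd big1 ?addr0// => l.
have [il|li|/val_inj->] := ltngtP i l; last by rewrite eqxx.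
  by rewrite Tt ?mul0r.
by rewrite [X in _ * X]IHt ?mulr0.
Qed.

Lemma mxtrace_unitary_conj (C : numClosedFieldType) n (P A : 'M[C]_n) :
  P \is unitarymx -> \tr (P *m A *m P^t*) = \tr A.
Proof.
by move=> Pu; rewrite mxtrace_mulC mulmxA (mulmx1C (unitarymxP Pu)) mul1mx.
Qed.

Lemma char_poly_unitary_conj (C : numClosedFieldType) n (P A : 'M[C]_n) :
  P \is unitarymx -> char_poly (P *m A *m P^t*) = char_poly A.
Proof.
move=> Pu; rewrite /char_poly /char_poly_mx.
have -> : 'X%:M - map_mx polyC (P *m A *m P^t*) =
    map_mx polyC P *m ('X%:M - map_mx polyC A) *m map_mx polyC (P^t*).
  rewrite mulmxBr mulmxBl -!map_mxM; congr (_ - _).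
  by rewrite scalar_mxC -mulmxA -map_mxM (unitarymxP Pu) map_mx1 mulmx1.
rewrite !det_mulmx mulrAC -det_mulmx -map_mxM (unitarymxP Pu) map_mx1.
by rewrite det1 mul1r.
Qed.

(** The diagonal and [s] factor the same characteristic polynomial, so they are permutations of each
    other. This frees later sums from any particular enumeration of the eigenvalues. *)
Lemma big_eigenvalues_trig (C : numClosedFieldType) (V : nmodType) n
    (T : 'M[C]_n) (s : seq C) (f : C -> V) : is_trig_mx T ->
  char_poly T = \prod_(x <- s) ('X - x%:P) ->
  \sum_(x <- s) f x = \sum_i f (T i i).
Proof.
move=> Tt Ts.
have : char_poly T = \prod_(x <- [seq T i i | i <- enum 'I_n]) ('X - x%:P).
  by rewrite big_map big_enum -char_poly_trig.
rewrite Ts => /perm_eq_prod_XsubC /(perm_big _) ->.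
by rewrite big_map big_enum.
Qed.

(** Schur triangularisation: unitary conjugation commutes with powers and keeps the trace, and a
    power of a triangular matrix has the powers of the eigenvalues on its diagonal. *)
Lemma mxtrace_exp_eigenvalues (C : numClosedFieldType) n (A : 'M[C]_n)
    (s : seq C) k : (0 < n)%N ->
  char_poly A = \prod_(x <- s) ('X - x%:P) ->
  \tr (A ^+ k) = \sum_(x <- s) x ^+ k.
Proof.
move=> n0 As; have [P Pu] := Schur A n0.
rewrite -[X in is_true X -> _]/(is_trig_mx (conjmx P A)) conjymx//.
set T := P *m A *m P^t* => Tt.
have TXE : T ^+ k = P *m (A ^+ k) *m P^t*.
  elim: k => [|k IH]; first by rewrite !expr0 mulmx1; apply/esym/unitarymxP.
  rewrite !exprS IH /T -!mulmxE -!mulmxA (mulmxA _ P).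
  by rewrite (mulmx1C (unitarymxP Pu)) mul1mx.
rewrite -(mxtrace_unitary_conj _ Pu)// -TXE.
rewrite /mxtrace (eq_bigr _ (fun i _ => (trig_mx_exp k Tt).2 i)).
by rewrite (big_eigenvalues_trig _ Tt)// /T char_poly_unitary_conj.
Qed.

(** By the spectral theorem one unitary matrix conjugates A to a diagonal D and its adjoint to that
    of D, so the trace becomes the sum of the squared moduli on the diagonal. *)
Lemma mxtrace_normal (C : numClosedFieldType) n (A : 'M[C]_n) (s : seq C) :
  A \is normalmx -> char_poly A = \prod_(x <- s) ('X - x%:P) ->
  \tr (A^t* *m A) = \sum_(x <- s) `|x| ^+ 2.
Proof.
move=> /orthomx_spectralP; have Pu := spectral_unitarymx A.
rewrite invmx_unitary//; set P := spectralmx A in Pu *.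
set D := diag_mx _ => AE As.
have PuV := mulmx1C (unitarymxP Pu).
have DE : P *m A *m P^t* = D.
  by rewrite AE -!mulmxA (unitarymxP Pu) mulmx1 mulmxA (unitarymxP Pu) mul1mx.
have DtE : P *m A^t* *m P^t* = D^t*.
  by rewrite -DE !trmx_mul !map_mxM/= trmxCK mulmxA.
rewrite -(mxtrace_unitary_conj _ Pu)//.
have -> : P *m (A^t* *m A) *m P^t* = D^t* *m D.
  by rewrite -DtE -DE -!mulmxA (mulmxA _ P) PuV mul1mx.
rewrite (@big_eigenvalues_trig _ _ _ D).
- apply: eq_bigr => i _; rewrite mxE (bigD1 i)//= big1 ?addr0.
    by rewrite !mxE eqxx mulr1n normCK mulrC.
  by move=> j ji; rewrite !mxE (negbTE ji) mulr0n rmorph0 mul0r.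
- exact/diag_mx_is_trig.
- by rewrite -DE char_poly_unitary_conj.
Qed.

(** * The gradient of the energy *)

(** Retyping the product (and below the adjoint) in [cmatrix] gives the result the real scaling and
    the Frobenius norm, instead of the complex scaling and max norm of ['M[R[i]]_d]. *)
Definition cmulmx (R : realType) (d : nat) (A B : cmatrix R d) : cmatrix R d :=
  A *m B.

Definition adjoint (R : realType) (d : nat) (A : cmatrix R d) : cmatrix R d :=
  A^t*.

Definition commutator (R : realType) (d : nat) (A B : cmatrix R d) :
  cmatrix R d := cmulmx A B - cmulmx B A.

Local Notation "A '**' B" := (cmulmx A B) (at level 40, left associativity).
Local Notation selfcomm A := (commutator A (adjoint A)).

Section Inner.
Variables (R : realType) (d : nat).
Implicit Types A B C H G : cmatrix R d.

Lemma cmulmxDl A B C : (A + B) ** C = A ** C + B ** C.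
Proof. exact: mulmxDl. Qed.

Lemma cmulmxDr A B C : A ** (B + C) = A ** B + A ** C.
Proof. exact: mulmxDr. Qed.

Lemma cmulmxA A B C : A ** (B ** C) = A ** B ** C.
Proof. exact: mulmxA. Qed.

Lemma cmulmxZl (a : R) A B : (a *: A) ** B = a *: (A ** B).
Proof.
apply/matrixP => i j; rewrite !mxE mulr_sumr; apply: eq_bigr => k _.
by rewrite !mxE mulrA.
Qed.

Lemma cmulmxZr (a : R) A B : A ** (a *: B) = a *: (A ** B).
Proof.
apply/matrixP => i j; rewrite !mxE mulr_sumr; apply: eq_bigr => k _.
by rewrite !mxE mulrCA.
Qed.

Lemma cmulmxNl A B : (- A) ** B = - (A ** B).
Proof. exact: mulNmx. Qed.

Lemma cmulmxNr A B : A ** (- B) = - (A ** B).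
Proof. exact: mulmxN. Qed.

Lemma adjointD A B : adjoint (A + B) = adjoint A + adjoint B.
Proof. by apply/matrixP => i j; rewrite !mxE rmorphD. Qed.

Lemma adjointN A : adjoint (- A) = - adjoint A.
Proof. by apply/matrixP => i j; rewrite !mxE rmorphN. Qed.

Lemma adjointK A : adjoint (adjoint A) = A.
Proof. exact: trmxCK. Qed.

Lemma adjointM A B : adjoint (A ** B) = adjoint B ** adjoint A.
Proof. by rewrite /adjoint /cmulmx trmx_mul map_mxM. Qed.

Lemma innerNl A B : inner (- A) B = - inner A B.
Proof. by rewrite -scaleN1r innerZl mulN1r. Qed.

Lemma innerNr A B : inner A (- B) = - inner A B.
Proof. by rewrite innerC innerNl innerC. Qed.

Lemma inner_adjoint A B : inner (adjoint A) (adjoint B) = inner A B.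
Proof.
rewrite !innerE exchange_big; apply: eq_bigr => i _; apply: eq_bigr => j _.
by rewrite !mxE; case: (A i j) (B i j) => [a b] [x y] /=; rewrite mulrNN.
Qed.

Lemma inner_cmulmxl A B C : inner (A ** B) C = inner B (adjoint A ** C).
Proof.
rewrite {2}/inner -[_^t*]/(adjoint (adjoint A ** C)) adjointM adjointK.
by rewrite /inner /cmulmx mulmxA.
Qed.

Lemma inner_cmulmxr A B C : inner (A ** B) C = inner A (C ** adjoint B).
Proof.
by rewrite -inner_adjoint adjointM inner_cmulmxl -adjointM inner_adjoint.
Qed.

Lemma sqr_norm_inner A : `|A| ^+ 2 = inner A A.
Proof. by rewrite -[`|A|]/(frobenius A) frobeniusE sqr_sqrtr// inner_ge0. Qed.

Lemma norm_adjoint A : `|adjoint A| = `|A|.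
Proof.
by rewrite -[LHS]/(frobenius _) frobeniusE inner_adjoint -frobeniusE.
Qed.

Lemma abs_inner_le A B : `|inner A B| <= `|A| * `|B|.
Proof.
rewrite ler_norml; apply/andP; split; last exact: inner_le.
by rewrite lerNl -innerNl -(normrN A); exact: inner_le.
Qed.

Lemma normc_entry_le A i j : normc (A i j) <= `|A|.
Proof.
rewrite -(@ler_sqr R) ?nnegrE ?normr_ge0// ?normc_ge0//; last first.
  by case: (A i j) => a b /=; rewrite sqrtr_ge0.
rewrite sqr_norm_inner inner_norm (bigD1 i)//= (bigD1 j)//= -addrA lerDl.
rewrite addr_ge0// sumr_ge0// => k _; rewrite ?sqr_ge0//.
by rewrite sumr_ge0// => *; rewrite sqr_ge0.
Qed.

Lemma norm_le_sum A : `|A| <= \sum_i \sum_j normc (A i j).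
Proof.
have n0 (z : R[i]) : 0 <= normc z by case: z => a b /=; rewrite sqrtr_ge0.
have sq (I : finType) (f : I -> R) : (forall i, 0 <= f i) ->
    \sum_i f i ^+ 2 <= (\sum_i f i) ^+ 2.
  move=> f0; rewrite expr2 mulr_sumr; apply: ler_sum => i _.
  rewrite expr2 ler_wpM2r// (bigD1 i)//= lerDl sumr_ge0// => *; exact: f0.
rewrite -ler_sqr ?nnegrE ?normr_ge0//; last first.
  by apply: sumr_ge0 => i _; apply: sumr_ge0.
rewrite sqr_norm_inner inner_norm.
apply: (le_trans _ (sq _ _ _)); last by move=> i; apply: sumr_ge0.
by apply: ler_sum => i _; apply: sq.
Qed.

(* The constant [d ^ 3] is crude (1 would do); any constant serves. *)
Lemma norm_cmulmx_le A B : `|A ** B| <= d%:R ^+ 3 * (`|A| * `|B|).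
Proof.
apply: (le_trans (norm_le_sum _)).
have e (i j : 'I_d) : normc ((A ** B) i j) <= d%:R * (`|A| * `|B|).
  have normc_sum (I : Type) (s : seq I) (f : I -> R[i]) :
      normc (\sum_(k <- s) f k) <= \sum_(k <- s) normc (f k).
    elim: s => [|k s IH]; rewrite ?big_nil ?normc0// !big_cons.
    by apply: (le_trans (le_normcD _ _)); rewrite lerD2l.
  rewrite mxE; apply: (le_trans (normc_sum _ _ _)).
  rewrite mulr_natl -[X in _ *+ X]card_ord -sumr_const; apply: ler_sum => k _.
  rewrite normcM ler_pM ?normc_entry_le//.
  - by case: (A i k) => a b /=; rewrite sqrtr_ge0.
  - by case: (B k j) => a b /=; rewrite sqrtr_ge0.
rewrite [X in _ <= X](_ : _ = \sum_(i < d) \sum_(j < d) (d%:R * (`|A| * `|B|))).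
  by apply: ler_sum => i _; apply: ler_sum => j _.
rewrite !sumr_const card_ord -[X in _ = X *+ d]mulr_natl -[RHS]mulr_natl.
ring.
Qed.

(** The arguments are swapped so that [innerr G] is a linear form, the candidate differential of a
    function with gradient [G]. *)
Definition innerr G H : R^o := inner H G.

Lemma innerr_linear G : linear (innerr G).
Proof. by move=> a A B; rewrite /innerr innerDl innerZl. Qed.

HB.instance Definition _ G := GRing.isLinear.Build R (cmatrix R d) R^o *:%R
  (innerr G) (innerr_linear G).

Lemma innerr_continuous G : continuous (innerr G).
Proof.
move=> A; apply/(@cvgrPdist_le _ _ _ (nbhs A)) => e e0.
near=> B; rewrite /innerr -innerNl -innerDl.
apply: (le_trans (abs_inner_le _ _)).
(* Adding 1 allows division by this bound even when [G = 0]. *)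
have G0 : 0 < `|G| + 1 by rewrite ltr_wpDl.
apply: (@le_trans _ _ (`|A - B| * (`|G| + 1))).
  by rewrite ler_wpM2l// lerDl.
rewrite -ler_pdivlMr//; near: B.
by apply: cvgr_dist_le; [exact: cvg_id|rewrite divr_gt0].
Unshelve. all: by end_near. Qed.

(** A remainder of order 2 is little-o of H, and uniqueness of the differential then identifies it
    with pairing against [G]. For a polynomial such as the energy this replaces the calculus of
    derivatives by one estimate. *)
Lemma is_gradient_quadratic (f : cmatrix R d -> R^o) A G (K : R) :
  (forall H, `|H| <= 1 -> `|f (A + H) - f A - inner H G| <= K * `|H| ^+ 2) ->
  is_gradient f A G.
Proof.
move=> fK; pose df : {linear cmatrix R d -> R^o} := (innerr G).
have dfo : f \o shift A = cst (f A) + df +o_ 0 id.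
  apply/eqaddoP => e e0; near=> H.
  rewrite -[X in `|X|]/(f (H + A) - (f A + inner H G)) opprD addrA addrC.
  rewrite (addrC H) (addrC (- inner H G)).
  have H1 : `|H| <= 1 by near: H; apply: cvgr0_norm_le; [exact: cvg_id|].
  apply: (le_trans (fK _ H1)).
  rewrite expr2 mulrA ler_wpM2r//.
  have K0 : 0 < `|K| + 1 by rewrite ltr_wpDl.
  apply: (@le_trans _ _ ((`|K| + 1) * `|H|)).
    by rewrite ler_wpM2r// (le_trans (ler_norm _))// lerDl.
  rewrite mulrC -ler_pdivlMr//; near: H.
  by apply: cvgr0_norm_le; [exact: cvg_id|rewrite divr_gt0].
have dfE := diff_unique (@innerr_continuous G : continuous df) dfo.
split; last by move=> H; rewrite dfE.
by apply/diff_locallyP; rewrite dfE; split; first exact: innerr_continuous.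
Unshelve. all: by end_near. Qed.

Lemma energyE A : energy A = inner (selfcomm A) (selfcomm A).
Proof. exact: sqr_norm_inner. Qed.

Lemma adjoint_selfcomm A : adjoint (selfcomm A) = selfcomm A.
Proof. by rewrite adjointD adjointN !adjointM !adjointK. Qed.

Lemma norm_commutator_le A B :
  `|commutator A B| <= 2 * d%:R ^+ 3 * (`|A| * `|B|).
Proof.
apply: (le_trans (ler_normB _ _)); rewrite -mulrA mulr_natl mulr2n.
by rewrite lerD ?norm_cmulmx_le// (mulrC `|A|) norm_cmulmx_le.
Qed.

Lemma selfcommD A H : selfcomm (A + H) =
  selfcomm A + (commutator A (adjoint H) + commutator H (adjoint A)) +
  selfcomm H.
Proof.
rewrite /commutator adjointD !cmulmxDl !cmulmxDr.
(* Only additivity in the eight products matters; once they are generalized, [ring] closes the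
   identity entrywise. *)
move: (A ** _) (A ** _) (H ** _) (H ** _) (_ ** A) (_ ** A) (_ ** H) (_ ** H).
by move=> a b c e u v w x; apply/matrixP => i j; rewrite !mxE; ring.
Qed.

(** Since C is self-adjoint and taking adjoints is an isometry, a matrix and its adjoint pair
    equally with C. The four products thus reduce to two, each counted twice, and moving the factor
    other than H across the pairing yields CA and AC. *)
Lemma inner_selfcomm_linear A H :
  inner (commutator A (adjoint H) + commutator H (adjoint A)) (selfcomm A) =
  2 * inner H (commutator (selfcomm A) A).
Proof.
set C := selfcomm A.
have CE B : inner (adjoint B) C = inner B C.
  by rewrite -{1}[C]adjoint_selfcomm inner_adjoint.
have e1 : inner (A ** adjoint H) C = inner (H ** adjoint A) C.
  by rewrite -CE adjointM adjointK.
have e2 : inner (adjoint H ** A) C = inner (adjoint A ** H) C.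
  by rewrite -CE adjointM adjointK.
rewrite {1 2}/commutator !innerDl !innerNl e1 e2 (inner_cmulmxr H).
rewrite (inner_cmulmxl (adjoint A)) adjointK /commutator innerDr innerNr.
ring.
Qed.

(** With C, L, Q of degrees 0, 1, 2 in H, the part of degree 1 is 2 <L, C> = 4 x; what is left has
    degree at least 2. *)
Lemma inner_expansion C L Q (x : R) : inner L C = 2 * x ->
  inner (C + L + Q) (C + L + Q) - inner C C - 4 * x =
  inner L L + 2 * inner Q C + 2 * inner L Q + inner Q Q.
Proof.
rewrite !innerDl !innerDr (innerC C L) (innerC C Q) (innerC Q L) => ->; ring.
Qed.

Lemma ler_norm_expansion (x y z w a b c e : R) :
  `|x| <= a -> `|y| <= b -> `|z| <= c -> `|w| <= e ->
  `|x + 2 * y + 2 * z + w| <= a + 2 * b + 2 * c + e.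
Proof. by rewrite !ler_norml; lra. Qed.

Lemma is_gradient_energy A :
  is_gradient (@energy R d) A (4 *: commutator (selfcomm A) A).
Proof.
set C := selfcomm A; pose k : R := 2 * d%:R ^+ 3; set a := `|A|.
have k0 : 0 <= k by rewrite mulr_ge0// exprn_ge0.
(* The four summands bound <L, L>, 2 <Q, C>, 2 <L, Q> and <Q, Q> by means of |L| <= 2 k a h and |Q|
   <= k h^2; the condition h <= 1 brings the cubic and quartic terms down to h^2. *)
apply: (@is_gradient_quadratic _ _ _
  ((2 * k * a) ^+ 2 + 2 * `|C| * k + 2 * (2 * k * a) * k + k ^+ 2)) => H.
set h := `|H| => h1.
(* [L] and [Q] are the parts of degree 1 and 2 in [H] of
   [selfcomm (A + H)]. *)
pose L := commutator A (adjoint H) + commutator H (adjoint A).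
pose Q := selfcomm H.
have -> : energy (A + H) - energy A - inner H (4 *: commutator C A) =
    inner L L + 2 * inner Q C + 2 * inner L Q + inner Q Q.
  have := inner_selfcomm_linear A H; rewrite innerZr !energyE selfcommD.
  exact: inner_expansion.
have Lle : `|L| <= 2 * k * a * h.
  rewrite /L (le_trans (ler_normD _ _))//.
  have := norm_commutator_le A (adjoint H).
  have := norm_commutator_le H (adjoint A).
  rewrite !norm_adjoint -/k -/a -/h (mulrC h); lra.
have Qle : `|Q| <= k * h ^+ 2.
  by rewrite (le_trans (norm_commutator_le _ _))// norm_adjoint expr2.
have h0 : 0 <= h by exact: normr_ge0.
have a0 : 0 <= a by exact: normr_ge0.
have [LL QC] := (abs_inner_le L L, abs_inner_le Q C).
have [LQ QQ] := (abs_inner_le L Q, abs_inner_le Q Q).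
have h2 : h ^+ 2 <= 1 by rewrite expr_le1.
have h20 : 0 <= h ^+ 2 by rewrite exprn_ge0.
have l0 : 0 <= 2 * k * a by rewrite !mulr_ge0.
have LL' : `|L| * `|L| <= (2 * k * a) ^+ 2 * h ^+ 2.
  by rewrite -exprMn expr2 ler_pM.
have QC' : `|Q| * `|C| <= `|C| * k * h ^+ 2.
  by rewrite mulrC -mulrA ler_wpM2l.
have LQ' : `|L| * `|Q| <= 2 * k * a * k * h ^+ 2.
  apply: (@le_trans _ _ ((2 * k * a * h) * (k * h ^+ 2))); first exact: ler_pM.
  rewrite (_ : _ * _ = 2 * k * a * k * h ^+ 2 * h); last by ring.
  by rewrite ler_piMr// !mulr_ge0.
have QQ' : `|Q| * `|Q| <= k ^+ 2 * h ^+ 2.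
  apply: (@le_trans _ _ ((k * h ^+ 2) * (k * h ^+ 2))); first exact: ler_pM.
  rewrite (_ : _ * _ = k ^+ 2 * h ^+ 2 * h ^+ 2); last by ring.
  by rewrite ler_piMr// !mulr_ge0.
rewrite [leRHS](_ : _ = (2 * k * a) ^+ 2 * h ^+ 2 + 2 * (`|C| * k * h ^+ 2) +
  2 * (2 * k * a * k * h ^+ 2) + k ^+ 2 * h ^+ 2); last by ring.
apply: ler_norm_expansion.
- exact: le_trans LL LL'.
- exact: le_trans QC QC'.
- exact: le_trans LQ LQ'.
- exact: le_trans QQ QQ'.
Qed.

Lemma gradient_energy A :
  gradient (@energy R d) A = 4 *: commutator (selfcomm A) A.
Proof. exact/gradientP/is_gradient_energy. Qed.

(** Pair the gradient direction with A itself: moving factors across the inner product gives <A,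
    [C, A]> = <[A, A^*], C> = <C, C>. *)
Lemma selfcomm_eq0_of_critical A :
  commutator (selfcomm A) A = 0 -> selfcomm A = 0.
Proof.
set C := selfcomm A => CA0; apply: inner_eq0.
rewrite -[RHS](_ : inner A (commutator C A) = 0); last first.
  by rewrite CA0 innerC -(scale0r 0) innerZl mul0r.
rewrite /commutator innerDr innerNr {1}/C /commutator innerDl innerNl.
by rewrite (inner_cmulmxr A) adjointK (inner_cmulmxl (adjoint A)) adjointK.
Qed.

End Inner.

(** * Curves of matrices *)

Section Flow.
Variables (R : realType) (d : nat).
Implicit Types A B C G V W : cmatrix R d.
Implicit Types phi psi : R -> cmatrix R d.

Lemma cvg_cmulmx (T : Type) (F : set_system T) {FF : Filter F}
    (f g : T -> cmatrix R d) A B :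
  f @ F --> A -> g @ F --> B -> (fun x => f x ** g x) @ F --> A ** B.
Proof.
move=> fA gB; pose k : R := d%:R ^+ 3.
have cvg0 (h : T -> cmatrix R d) C : h @ F --> C ->
    (fun x => `|h x - C|) @ F --> (0 : R).
  move=> hC; rewrite -(normr0 (cmatrix R d)) -(subrr C); apply: cvg_norm.
  by apply: cvgB => //; exact: cvg_cst.
(* [r] bounds the norm of f g - A B = (f - A)(g - B) + (f - A) B + A (g - B), term by term. *)
pose r x : R := k * (`|f x - A| * `|g x - B|) + k * (`|f x - A| * `|B|)
  + k * (`|A| * `|g x - B|).
have r0 : r @ F --> (0 : R).
  have -> : (0 : R) = k * (0 * 0) + k * (0 * `|B|) + k * (`|A| * 0) by ring.
  by apply: cvgD; [apply: cvgD|]; apply: cvgM; try exact: cvg_cst;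
    apply: cvgM; try exact: cvg_cst; exact: cvg0.
apply/cvgrPdist_le => e e0.
near=> x; rewrite distrC.
have -> : f x ** g x - A ** B =
    (f x - A) ** (g x - B) + (f x - A) ** B + A ** (g x - B).
  rewrite -cmulmxDr subrK cmulmxDl cmulmxDr cmulmxNl cmulmxNr.
  by rewrite addrA subrK.
apply: (@le_trans _ _ (r x)); last first.
  by rewrite (le_trans (ler_norm _))//; near: x; exact: cvgr0_norm_le.
apply: (le_trans (ler_normD _ _)); rewrite lerD ?norm_cmulmx_le//.
by apply: (le_trans (ler_normD _ _)); rewrite lerD ?norm_cmulmx_le.
Unshelve. all: by end_near. Qed.

Lemma cvg_adjoint (T : Type) (F : set_system T) {FF : Filter F}
    (f : T -> cmatrix R d) A :
  f @ F --> A -> (fun x => adjoint (f x)) @ F --> adjoint A.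
Proof.
move=> /cvgrPdist_le fA; apply/cvgrPdist_le => e /fA; apply: filterS => x.
by rewrite -adjointN -adjointD norm_adjoint.
Qed.

Lemma cvg_inner (T : Type) (F : set_system T) {FF : Filter F}
    (f : T -> cmatrix R d) A G :
  f @ F --> A -> inner (f x) G @[x --> F] --> inner A G.
Proof.
move=> fA; apply: (@cvg_comp _ _ _ f (innerr G) _ (nbhs A)) => //.
exact: innerr_continuous.
Qed.

(** Differentiability implies continuity within the time domain: [phi (t + h)] is h times the
    difference quotient, plus [phi t]. At t = 0 this is continuity from the right. *)
Lemma has_time_derivative_cvg phi t V : has_time_derivative phi t V ->
  phi (t + h) @[h --> within [set h | 0 <= t + h] (0 : R)^'] --> phi t.
Proof.
move=> phiV.
have h0 : h @[h --> within [set h | 0 <= t + h] (0 : R)^'] --> (0 : R).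
  by apply: cvg_trans (cvg_within _) _; exact: cvg_within.
have cv : h *: (h^-1 *: (phi (t + h) - phi t)) + phi t
    @[h --> within [set h | 0 <= t + h] (0 : R)^'] --> phi t.
  rewrite -[X in _ --> X]add0r -(scale0r V).
  by apply: cvgD; [exact: cvgZ|exact: cvg_cst].
apply: (cvg_trans _ cv); apply: near_eq_cvg.
rewrite /= near_withinE; near=> h => _; rewrite scalerA mulfV ?scale1r ?subrK//.
by near: h; exact: nbhs_dnbhs_neq.
Unshelve. all: by end_near. Qed.

(** At an interior time the constraint [0 <= t + h] holds as soon as |h| < t, so the restricted
    limit is the usual two-sided one. *)
Lemma is_derive_inner phi t V G : 0 < t -> has_time_derivative phi t V ->
  is_derive t (1 : R) (fun s => inner (phi s) G : R^o) (inner V G).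
Proof.
move=> t0 phiV.
have : h^-1 *: (inner (phi (h *: 1 + t)) G - inner (phi t) G : R^o)
    @[h --> (0 : R)^'] --> (inner V G : R^o).
  have : inner (h^-1 *: (phi (t + h) - phi t)) G
      @[h --> (0 : R)^'] --> inner V G.
    apply: cvg_inner; apply: (cvg_trans _ phiV) => P hP.
    have tD : \forall h \near (0 : R)^', 0 <= t + h.
      apply: nbhs_dnbhs; near=> h.
      have : `|h| < t by near: h; apply: cvgr0_norm_lt; [exact: cvg_id|].
      by rewrite ltr_norml => /andP[]; lra.
    by apply: filterS2 tD hP => h ? ; exact.
  move=> cv; apply: (cvg_trans _ cv); apply: near_eq_cvg; near=> h.
  by rewrite innerZl innerDl innerNl [h *: 1]mulr1 (addrC h).
move=> ?; apply: DeriveDef; first by apply/cvg_ex; exists (inner V G).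
exact: cvg_lim.
Unshelve. all: by end_near. Qed.

(** The mean value theorem fails for curves of matrices, hence the pairing with a fixed [G], which
    makes the curve real-valued. *)
Lemma inner_MVT phi (V : R -> cmatrix R d) G s t :
  (forall u, 0 <= u -> has_time_derivative phi u (V u)) -> 0 <= s < t ->
  exists2 c, s < c < t &
    inner (phi t) G - inner (phi s) G = inner (V c) G * (t - s).
Proof.
move=> phiV /andP[s0 st].
have dphi u : s < u ->
    is_derive u (1 : R) (fun s => inner (phi s) G : R^o) (inner (V u) G).
  by move=> su; apply: is_derive_inner; [exact: le_lt_trans su|
    apply/phiV/ltW/(le_lt_trans s0)].
have cphi u : s < u -> {for u, continuous (fun s => inner (phi s) G : R^o)}.
  by move=> /dphi [/derivable1_diffP/differentiable_continuous].
have [||c ct ->] := @MVT R (fun s => inner (phi s) G)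
  (fun s => inner (V s) G) _ _ st.
- by move=> u; rewrite in_itv => /andP[/dphi].
- apply/continuous_within_itvP => //; split.
  + by move=> u; rewrite in_itv => /andP[/cphi].
  (* The left endpoint may be 0, where only right continuity is available; it is used with the
     increment [x - s]. *)
  + apply: cvg_inner; apply/cvgrPdist_le => e e0.
    have /cvgrPdist_le/(_ e e0) := has_time_derivative_cvg (phiV s s0).
    move=> [r /= r0 rP]; exists r => //= x xr xs.
    have := rP (x - s).
    rewrite /ball_ /= sub0r opprB (addrC s (x - s)) subrK; apply => //.
    - by rewrite subr_eq0 gt_eqF.
    - exact: le_trans (ltW xs).
  + exact/cvg_at_left_filter/cphi.
by exists c => //; move: ct; rewrite in_itv.
Qed.

Lemma has_time_derivative_cmulmx phi psi t V W :
  has_time_derivative phi t V -> has_time_derivative psi t W ->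
  has_time_derivative (fun s => phi s ** psi s) t (V ** psi t + phi t ** W).
Proof.
move=> phiV psiW.
have cv : (h^-1 *: (phi (t + h) - phi t)) ** psi (t + h) +
    phi t ** (h^-1 *: (psi (t + h) - psi t))
    @[h --> within [set h | 0 <= t + h] (0 : R)^'] --> V ** psi t + phi t ** W.
  apply: cvgD; apply: cvg_cmulmx => //; last exact: cvg_cst.
  exact: has_time_derivative_cvg psiW.
apply: (cvg_trans _ cv); apply: near_eq_cvg; near=> h.
rewrite cmulmxZl cmulmxZr -scalerDr cmulmxDl cmulmxDr cmulmxNl cmulmxNr.
by rewrite addrA subrK.
Unshelve. all: by end_near. Qed.

Definition cexpmx A k : cmatrix R d := A ^+ k.

Lemma cexpmxS A k : cexpmx A k.+1 = cexpmx A k ** A.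
Proof. exact: exprSr. Qed.

(** The map [-, B] is a derivation, so the product rule carries the Lax equation from [phi] to its
    powers. *)
Lemma has_time_derivative_cexpmx phi t B k :
  has_time_derivative phi t (commutator (phi t) B) ->
  has_time_derivative (fun s => cexpmx (phi s) k) t
    (commutator (cexpmx (phi t) k) B).
Proof.
move=> phiB; elim: k => [|k IH].
  rewrite (_ : commutator _ _ = 0).
    rewrite /has_time_derivative /cexpmx.
    under eq_fun do rewrite !expr0 subrr scaler0.
    exact: cvg_cst.
  by rewrite /commutator /cexpmx expr0 /cmulmx mul1mx mulmx1 subrr.
under [X in has_time_derivative X]eq_fun do rewrite cexpmxS.
rewrite cexpmxS.
rewrite (_ : commutator _ _ = commutator (cexpmx (phi t) k) B ** phi t +
    cexpmx (phi t) k ** commutator (phi t) B).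
  exact: (@has_time_derivative_cmulmx (fun s => cexpmx (phi s) k) phi).
rewrite /commutator cmulmxDl cmulmxDr cmulmxNl cmulmxNr !cmulmxA.
by rewrite [RHS]addrC addrA subrK.
Qed.

Lemma cvg_cexpmx (T : Type) (F : set_system T) {FF : Filter F}
    (f : T -> cmatrix R d) A k :
  f @ F --> A -> (fun x => cexpmx (f x) k) @ F --> cexpmx A k.
Proof.
move=> fA; elim: k => [|k IH]; first exact: cvg_cst.
under eq_fun do rewrite cexpmxS.
by rewrite cexpmxS; exact: cvg_cmulmx.
Qed.

(** Scalar matrices turn traces into pairings with a fixed matrix, the form to which [inner_MVT]
    applies. *)
Lemma inner_scalar_mx A (c : R[i]) : inner A c%:M = complex.Re (c^* * \tr A).
Proof.
by rewrite /inner tr_scalar_mx map_scalar_mx mul_scalar_mx mxtraceZ.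
Qed.

Lemma inner_commutator_scalar_mx A B (c : R[i]) :
  inner (commutator A B) c%:M = 0.
Proof.
have tr0 : \tr (A *m B - B *m A) = 0 by rewrite raddfB/= mxtrace_mulC subrr.
by rewrite inner_scalar_mx [\tr _]tr0 mulr0.
Qed.

End Flow.

(** * Spectrum and limit of the flow *)

Section Lax.
Variables (R : realType) (d : nat) (F : cmatrix R d -> R -> cmatrix R d).
Hypothesis hF : negative_gradient_flow (@energy R d) F.
Implicit Types A B C : cmatrix R d.

Lemma flow_derivative A t : 0 <= t ->
  has_time_derivative (F A) t (commutator (F A t) (4 *: selfcomm (F A t))).
Proof.
move=> /((hF A).2); rewrite gradient_energy /commutator cmulmxZl cmulmxZr.
by rewrite -[4 *: (_ ** _) - _]scalerBr -scalerN opprB.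
Qed.

(** The pairing of the k-th power with a scalar matrix has as derivative the pairing of a
    commutator, which is 0. It keeps its value from time 0, and by continuity it tends to its value
    at [B]. *)
Lemma mxtrace_cexpmx_flow A B k : F A t @[t --> +oo] --> B ->
  \tr (cexpmx A k) = \tr (cexpmx B k).
Proof.
move=> AB; have trE c : inner (cexpmx A k) c%:M = inner (cexpmx B k) c%:M.
  have cst t : 0 < t -> inner (cexpmx (F A t) k) c%:M = inner (cexpmx A k) c%:M.
    move=> t0; have [||u _] := @inner_MVT _ _ (fun s => cexpmx (F A s) k)
      (fun s => commutator (cexpmx (F A s) k) (4 *: selfcomm (F A s))) c%:M 0 t.
    - by move=> s s0; exact/has_time_derivative_cexpmx/flow_derivative.
    - by rewrite lexx t0.
    by rewrite inner_commutator_scalar_mx mul0r (hF A).1 => /subr0_eq.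
  have cv : inner (cexpmx (F A t) k) c%:M
      @[t --> +oo] --> inner (cexpmx B k) c%:M.
    by apply: cvg_inner; apply: cvg_cexpmx.
  have cv' : inner (cexpmx (F A t) k) c%:M
      @[t --> +oo] --> inner (cexpmx A k) c%:M.
    apply: cvg_near_cst; near=> t; apply: cst; near: t.
    exact: nbhs_pinfty_gt.
  exact: (cvg_unique (@Rhausdorff R) cv' cv).
(* [c = 1] and [c = 'i] give the real and the imaginary part of the trace. *)
apply/eqP; rewrite eq_complex; apply/andP; split; apply/eqP.
  by have := trE 1; rewrite !inner_scalar_mx rmorph1 !mul1r.
have := trE 'i; rewrite !inner_scalar_mx.
case: (\tr _) (\tr _) => [a b] [x y] /=.
by rewrite !mul0r !sub0r !mulN1r !opprK.
Unshelve. all: by end_near. Qed.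

(** Here p and q are values at times t and t + 1, l is their limit and v the velocity in between: q
    - p is less than e / 2, while v exceeds e / 2. *)
Lemma small_increment (p q l v e : R) : 0 < e ->
  `|l - p| < e / 4 -> `|l - q| < e / 4 -> `|e - v| < e / 2 -> q - p <> v.
Proof. by rewrite !ltr_norml; lra. Qed.

(* If the velocity [V B] at the limit were nonzero, [inner (F A t) (V B)] would
   eventually grow by at least [inner (V B) (V B) / 2] per unit of time. *)
Lemma flow_limit_normal A B : F A t @[t --> +oo] --> B -> selfcomm B = 0.
Proof.
move=> AB; apply: selfcomm_eq0_of_critical.
pose V C : cmatrix R d := commutator C (4 *: selfcomm C).
have VE C : V C = - 4 *: commutator (selfcomm C) C.
  rewrite /V /commutator cmulmxZl cmulmxZr.
  by rewrite -[4 *: (_ ** _) - _]scalerBr scaleNr -scalerN opprB.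
suff : V B = 0.
  by rewrite VE => /eqP; rewrite scaler_eq0 oppr_eq0 pnatr_eq0/= => /eqP.
apply: inner_eq0; apply/eqP/contraT => VB0.
pose e := inner (V B) (V B); have e0 : 0 < e by rewrite lt0r VB0 inner_ge0.
have cV : V (F A t) @[t --> +oo] --> V B.
  have c1 : adjoint (F A t) @[t --> +oo] --> adjoint B by exact: cvg_adjoint.
  have c2 : selfcomm (F A t) @[t --> +oo] --> selfcomm B.
    by apply: cvgB; exact: cvg_cmulmx.
  have c3 : 4 *: selfcomm (F A t) @[t --> +oo] --> 4 *: selfcomm B.
    by apply: cvgZr.
  by apply: cvgB; exact: cvg_cmulmx.
have cvV : inner (V (F A t)) (V B) @[t --> +oo] --> e.
  exact: cvg_inner.
have cvF : inner (F A t) (V B) @[t --> +oo] --> inner B (V B).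
  exact: cvg_inner.
have e4 : 0 < e / 4 by rewrite divr_gt0.
have e2 : 0 < e / 2 by rewrite divr_gt0.
have /cvgrPdist_lt/(_ _ e4) [M1 [_ hM1]] := cvF.
have /cvgrPdist_lt/(_ _ e2) [M2 [_ hM2]] := cvV.
(* From this t on, the unit interval up to t + 1 lies in the time domain and in the range of both
   estimates; the final 1 makes the inequalities strict. *)
pose t := Num.max 0 (Num.max M1 M2) + 1.
have t0 : 0 <= t by rewrite addr_ge0// le_max lexx.
have t1 : M1 < t by rewrite ltr_pwDr// !le_max lexx orbT.
have t2 : M2 < t by rewrite ltr_pwDr// !le_max lexx !orbT.
have [||c /andP[tc _]] :=
  @inner_MVT _ _ (F A) (fun s => V (F A s)) (V B) t (t + 1).
- by move=> u /flow_derivative.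
- by rewrite t0 ltrDl ltr01.
rewrite (addrC t) addrK mulr1 => increment; exfalso.
apply: (small_increment e0 (hM1 _ t1) _ (hM2 _ (lt_trans t2 tc)) increment).
by apply: hM1; rewrite /= (lt_trans t1)// ltrDr ltr01.
Qed.

End Lax.

Theorem corollary2p8 (R : realType) (d : nat) (hd : (1 <= d)%N)
  (F : cmatrix R d -> R -> cmatrix R d)
  (hF : negative_gradient_flow (@energy R d) F)
  (A0 Ainf : cmatrix R d)
  (hlim : F A0 t @[t --> +oo] --> Ainf) :
  `|A0| ^+ 2 - `|Ainf| ^+ 2 = henrici A0.
Proof.
(* It remains to show that the squared norm of the limit is the sum of |lambda|^2 over the
   eigenvalues of [A0]. *)
congr (_ - _); rewrite sqr_norm_inner.
have An : (Ainf : 'M[R[i]]_d) \is normalmx.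
  by apply/normalmxP/subr0_eq; exact: (flow_limit_normal hF hlim).
rewrite /inner (mxtrace_normal An (eigenvaluesP Ainf)).
(* Normality gives this sum over the eigenvalues of [Ainf]; equal power sums, that is conserved
   traces of powers, allow passing to those of [A0]. *)
rewrite (@eq_sum_of_eq_power_sums _ _ (eigenvalues A0)).
  rewrite raddf_sum; apply: eq_bigr => l _.
  by rewrite normc_def -rmorphXn; case: l.
move=> k; apply: etrans (mxtrace_exp_eigenvalues k hd (eigenvaluesP A0)).
apply: etrans (esym (mxtrace_exp_eigenvalues k hd (eigenvaluesP Ainf))) _.
exact/esym/(mxtrace_cexpmx_flow hF).
Qed.
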